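(* Let $r,k\ge 1$ and let $M$ be a Baxter matrix with $r$ rows and $k$ columns. Then the number of extra 1s in $M$ is less than $r$.
   Context: Let $M$ be an $r\times k$ matrix of 0s and 1s. For $1\le x\le r-1$, $1\le y\le k-1$, the clockwise pinwheel of index $(x,y)$ has four segments of entries: $A_{x,y}=\{M[i,y+1]:1\le i\le x\}$, $B_{x,y}=\{M[x,i]:1\le i\le y\}$, $C_{x,y}=\{M[x+1,i]:y+1\le i\le k\}$, $D_{x,y}=\{M[i,y]:x+1\le i\le r\}$. The counterclockwise pinwheel of index $(x,y)$ has four segments: $A'_{x,y}=\{M[i,y]:1\le i\le x\}$, $B'_{x,y}=\{M[x+1,i]:1\le i\le y\}$, $C'_{x,y}=\{M[x,i]:y+1\le i\le k\}$, $D'_{x,y}=\{M[i,y+1]:x+1\le i\le r\}$. $M$ is a Baxter matrix if every row contains at least one 1, every column contains at least one 1, and for every clockwise and every counterclockwise pinwheel at least one of its four segments contains only 0s. An extra 1 of $M$ is an entry equal to 1 that is not the topmost 1 in its column (row 1 is the top row). *)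

(* Defs.v *)
From mathcomp Require Import all_boot all_algebra.
Set Implicit Arguments.
Unset Strict Implicit.
Unset Printing Implicit Defensive.

(* A 0/1 matrix is an 'M[bool]_(r, k), true standing for 1. Ordinals count
   from 0, so p = (i, j) : 'I_r * 'I_k is the position in row i.+1 and
   column j.+1 in the usual 1-based numbering, row 1 being the top row.
   Pinwheel indices (x, y) keep their 1-based meaning, 1 <= x <= r - 1 and
   1 <= y <= k - 1; e.g. "p.1 < x" is "row number at most x" and
   "p.2 == y :> nat" is "column number y + 1". *)

Section Baxter.
Variables r k : nat.
Implicit Types (M : 'M[bool]_(r, k)) (x y : nat).

Definition cwA x y : {set 'I_r * 'I_k} :=
  [set p : 'I_r * 'I_k | (p.1 < x) && (p.2 == y :> nat)].
Definition cwB x y : {set 'I_r * 'I_k} :=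
  [set p : 'I_r * 'I_k | (p.1.+1 == x) && (p.2 < y)].
Definition cwC x y : {set 'I_r * 'I_k} :=
  [set p : 'I_r * 'I_k | (p.1 == x :> nat) && (y <= p.2)].
Definition cwD x y : {set 'I_r * 'I_k} :=
  [set p : 'I_r * 'I_k | (x <= p.1) && (p.2.+1 == y)].

Definition ccwA x y : {set 'I_r * 'I_k} :=
  [set p : 'I_r * 'I_k | (p.1 < x) && (p.2.+1 == y)].
Definition ccwB x y : {set 'I_r * 'I_k} :=
  [set p : 'I_r * 'I_k | (p.1 == x :> nat) && (p.2 < y)].
Definition ccwC x y : {set 'I_r * 'I_k} :=
  [set p : 'I_r * 'I_k | (p.1.+1 == x) && (y <= p.2)].
Definition ccwD x y : {set 'I_r * 'I_k} :=
  [set p : 'I_r * 'I_k | (x <= p.1) && (p.2 == y :> nat)].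

Definition only_zeros M (S : {set 'I_r * 'I_k}) : bool :=
  [forall p in S, ~~ M p.1 p.2].

Definition cw_ok M x y : bool :=
  [|| only_zeros M (cwA x y), only_zeros M (cwB x y),
      only_zeros M (cwC x y) | only_zeros M (cwD x y)].

Definition ccw_ok M x y : bool :=
  [|| only_zeros M (ccwA x y), only_zeros M (ccwB x y),
      only_zeros M (ccwC x y) | only_zeros M (ccwD x y)].

Definition Baxter_matrix M : Prop :=
  [/\ forall i, exists j, M i j,
      forall j, exists i, M i j,
      forall x y, 0 < x < r -> 0 < y < k -> cw_ok M x y
    & forall x y, 0 < x < r -> 0 < y < k -> ccw_ok M x y].

Definition topmost_one M (i : 'I_r) (j : 'I_k) : bool :=
  M i j && [forall i' : 'I_r, (i' < i) ==> ~~ M i' j].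

Definition extra_ones M : {set 'I_r * 'I_k} :=
  [set p : 'I_r * 'I_k | M p.1 p.2 && ~~ topmost_one M p.1 p.2].

End Baxter.

(* Main.v *)
Require Import Defs.
From mathcomp Require Import all_boot all_algebra.

(** A 1 is extra when some 1 lies above it in its column; call it low-extra
    when some 1 lies below it. Since every column has exactly one topmost and
    exactly one bottommost 1, there are equally many extra and low-extra 1s,
    so it is enough to show that together they number at most [2 * (r - 1)].
    The first row has no extra 1 and the last row no low-extra 1. It therefore
    suffices to pair the low-extra 1s of each row with the extra 1s of the next
    row, and to show that each of these [r - 1] groups has at most two members
    ([card_extra_low_extra_le2]).

    Fix consecutive rows u and v, with sets P and Q of columns of their 1s, and
    let U and L be the sets of columns with a 1 weakly above u, respectively
    weakly below v. Then [P \subset U], [Q \subset L], U and L cover all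
    columns, and the group in question has [#|P :&: L| + #|Q :&: U|] members.
    The counterclockwise pinwheels forbid a column of U immediately followed by
    one of L when an element of Q lies to the left and one of P to the right.
    Because U and L cover everything, a column of U followed at any distance by
    one of L contains such an adjacent pair, so the prohibition holds at any
    distance ([no_switch]); the clockwise pinwheels give the same
    with the roles of (P, U) and (Q, L) exchanged. Now if [Q :&: U] contains
    q < q', these prohibitions put all of P strictly between q and q' and keep
    P away from L ([straddled], [straddled_disjoint]). Hence
    [Q :&: U] has no third element and [P :&: L] is empty. By symmetry, two
    elements of [P :&: L] leave [Q :&: U] empty, and the sum is at most 2. *)

Set Implicit Arguments.
Unset Strict Implicit.
Unset Printing Implicit Defensive.

(** * Interlacing sets of columns *)

(** The pinwheel conditions along one boundary between rows, freed from the
    adjacency of the columns [a] and [b]. *)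
Definition no_switch k (P Q U L : {set 'I_k}) : Prop :=
  forall q a b p : 'I_k, q \in Q -> a \in U -> b \in L -> p \in P ->
    q <= a -> a < b -> b <= p -> False.

(** Take for [d] the first element of [L] after [a]: the column before it is
    either [a] itself or outside [L], hence in [U]. *)
Lemma adjacent_switch k (U L : {set 'I_k}) (a b : 'I_k) :
    (forall j, (j \in U) || (j \in L)) -> a \in U -> b \in L -> a < b ->
  exists c d : 'I_k,
    [/\ c \in U, d \in L, d = c.+1 :> nat, a <= c & d <= b].
Proof.
move=> cover aU bL ab.
have hb : (b \in L) && (a < b) by rewrite bL.
case: (arg_minnP (P := fun j : 'I_k => (j \in L) && (a < j))
  (fun j : 'I_k => val j) hb) => d /andP[dL ad] dmin.
have d_gt0 : 0 < d by apply: leq_ltn_trans ad.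
have ck : d.-1 < k by apply: leq_ltn_trans (ltn_ord d); apply: leq_pred.
have ac : a <= d.-1 by rewrite -ltnS prednK.
exists (Ordinal ck), d; split=> //=; last by apply: dmin.
  case: (ltngtP a d.-1) ac => // [ac _ | ac _]; last first.
    by have -> : Ordinal ck = a by apply: val_inj.
  have := cover (Ordinal ck); case/orP => // cL.
  by have := dmin (Ordinal ck); rewrite cL ac /= leqNgt ltn_predL d_gt0 => /(_ isT).
by rewrite prednK.
Qed.

Section Straddling.
Variables (k : nat) (P Q U L : {set 'I_k}).
Hypothesis PQ : no_switch P Q U L.
Hypothesis QP : no_switch Q P L U.
Hypothesis subQL : Q \subset L.

(** Were [p] weakly to the left of [q], the step from [q], in [L], to [q'], in
    [U], would be forbidden; were it weakly to the right of [q'], the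
    step from [q], in [U], to [q'], in [L]. *)
Lemma straddled (q q' p : 'I_k) :
  q \in Q :&: U -> q' \in Q :&: U -> q < q' -> p \in P -> q < p < q'.
Proof.
move=> /setIP[qQ qU] /setIP[q'Q q'U] qq' pP.
have qL := subsetP subQL _ qQ; have q'L := subsetP subQL _ q'Q.
apply/andP; split; rewrite ltnNge; apply/negP => le.
  exact: (QP pP qL q'U q'Q).
exact: (PQ qQ qU q'L pP).
Qed.

Lemma straddled_disjoint (q q' : 'I_k) :
  q \in Q :&: U -> q' \in Q :&: U -> q < q' -> P :&: L = set0.
Proof.
move=> hq hq' qq'; apply/setP => p; rewrite inE in_set0.
apply/negP => /andP[pP pL].
have /andP[qp _] := straddled hq hq' qq' pP.
by case/setIP: hq => qQ qU; apply: (PQ qQ qU pL pP).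
Qed.

(** With three elements in [Q :&: U], any element of [P] would lie both to the
    left and to the right of the middle one. *)
Lemma straddling_le2 : P != set0 -> 1 < #|Q :&: U| ->
  #|Q :&: U| <= 2 /\ P :&: L = set0.
Proof.
case/set0Pn => p pP /card_gt1P[q [q' [hq hq' nqq']]].
wlog lt : q q' hq hq' nqq' / q < q'.
  move=> W; case: (ltngtP q q') => [lt | lt | /val_inj E].
  - exact: (W q q').
  - by apply: (W q' q) => //; rewrite eq_sym.
  - by rewrite E eqxx in nqq'.
split; last exact: straddled_disjoint lt.
have /andP[qp pq'] := straddled hq hq' lt pP.
have sub : Q :&: U \subset [set q; q'].
  apply/subsetP => c hc; rewrite !inE.
  case: (ltngtP c p) => [cp | pc | /val_inj cp].
  - case: (ltngtP c q) => [ltc | ltc | /val_inj ->]; rewrite ?eqxx //.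
      by have := straddled hc hq ltc pP; rewrite (ltnNge p q) (ltnW qp) andbF.
    by have := straddled hq hc ltc pP; rewrite (ltnNge p c) (ltnW cp) andbF.
  - case: (ltngtP c q') => [ltc | ltc | /val_inj ->]; rewrite ?eqxx ?orbT //.
      by have := straddled hc hq' ltc pP; rewrite (ltnNge c p) (ltnW pc).
    by have := straddled hq' hc ltc pP; rewrite (ltnNge q' p) (ltnW pq').
  - have qc : q < c by rewrite cp.
    by have := straddled hq hc qc pP; rewrite cp ltnn andbF.
by apply: leq_trans (subset_leq_card sub) _; rewrite cards2 nqq'.
Qed.

End Straddling.

Lemma card_switch_le2 k (P Q U L : {set 'I_k}) :
    no_switch P Q U L -> no_switch Q P L U -> P \subset U -> Q \subset L ->
    P != set0 -> Q != set0 ->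
  #|Q :&: U| + #|P :&: L| <= 2.
Proof.
move=> PQ QP PU QL Pn0 Qn0.
have [Qle|Qgt] := leqP #|Q :&: U| 1; last first.
  have [le2 ->] := straddling_le2 PQ QP QL Pn0 Qgt.
  by rewrite cards0 addn0.
have [Ple|Pgt] := leqP #|P :&: L| 1; first exact: (leq_add Qle Ple).
have [le2 ->] := straddling_le2 QP PQ PU Qn0 Pgt.
by rewrite cards0.
Qed.

(** * Two consecutive rows *)

Definition row_ones r k (M : 'M[bool]_(r, k)) (i : 'I_r) : {set 'I_k} :=
  [set j | M i j].

Definition ones_down_to r k (M : 'M[bool]_(r, k)) (i : 'I_r) : {set 'I_k} :=
  [set j | [exists i' : 'I_r, (i' <= i) && M i' j]].

Definition ones_down_from r k (M : 'M[bool]_(r, k)) (i : 'I_r) : {set 'I_k} :=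
  [set j | [exists i' : 'I_r, (i <= i') && M i' j]].

Definition low_extra_ones r k (M : 'M[bool]_(r, k)) : {set 'I_r * 'I_k} :=
  [set p | M p.1 p.2 && [exists i' : 'I_r, (p.1 < i') && M i' p.2]].

Lemma extra_onesE r k (M : 'M[bool]_(r, k)) (i : 'I_r) (j : 'I_k) :
  ((i, j) \in extra_ones M) = M i j && [exists i' : 'I_r, (i' < i) && M i' j].
Proof.
rewrite inE /topmost_one /=; case: (M i j) => //=.
rewrite negb_forall; apply: eq_existsb => i'.
by rewrite negb_imply negbK.
Qed.

Lemma only_zerosPn r k (M : 'M[bool]_(r, k)) (S : {set 'I_r * 'I_k}) i j :
  (i, j) \in S -> M i j -> only_zeros M S = false.
Proof.
move=> ijS Mij; apply/negbTE/negP => /forallP/(_ (i, j)).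
by rewrite ijS /= Mij.
Qed.

Section ConsecutiveRows.
Variables (r k : nat) (M : 'M[bool]_(r, k)) (u v : 'I_r).
Hypothesis hM : Baxter_matrix M.
Hypothesis vE : v = u.+1 :> nat.

Lemma ones_down_cover j : (j \in ones_down_to M u) || (j \in ones_down_from M v).
Proof.
have [_ /(_ j)[i Mij] _ _] := hM.
rewrite !inE; have [le | lt] := leqP i u; apply/orP; [left | right];
  apply/existsP; exists i; rewrite Mij andbT //.
by rewrite vE.
Qed.

(** An adjacent switch from U to L in the columns c and d = c + 1 makes the
    vertical segments of the counterclockwise pinwheel of index (v, d) nonzero;
    [q] and [p] do the same for its horizontal segments. In the 1-based indexing
    of pinwheels, v is the number of row u and d that of column c. *)
Lemma no_switch_ccw :
  no_switch (row_ones M u) (row_ones M v)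
            (ones_down_to M u) (ones_down_from M v).
Proof.
move=> q a b p; rewrite inE [p \in _]inE => Mvq aU bL Mup qa ab bp.
have [c [d [cU dL dE ac db]]] := adjacent_switch ones_down_cover aU bL ab.
have [_ _ _ /(_ v d)] := hM.
have v0 : 0 < v < r by rewrite ltn_ord vE.
have d0 : 0 < d < k by rewrite ltn_ord dE.
move: cU dL; rewrite !inE => /existsP[i /andP[iu Mic]] /existsP[i' /andP[vi Mid]].
move/(_ v0 d0); rewrite /ccw_ok.
rewrite (only_zerosPn (i := i) (j := c)) //; last by rewrite inE /= vE ltnS iu dE /=.
rewrite (only_zerosPn (i := v) (j := q)) //; last first.
  by rewrite inE /= eqxx dE ltnS (leq_trans qa).
rewrite (only_zerosPn (i := u) (j := p)) //; last first.
  by rewrite inE /= vE eqxx (leq_trans db).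
by rewrite (only_zerosPn (i := i') (j := d)) // inE /= vi eqxx.
Qed.

Lemma no_switch_cw :
  no_switch (row_ones M v) (row_ones M u)
            (ones_down_from M v) (ones_down_to M u).
Proof.
move=> p a b q; rewrite inE [q \in _]inE => Mup aL bU Mvq pa ab bq.
have cover j : (j \in ones_down_from M v) || (j \in ones_down_to M u).
  by rewrite orbC ones_down_cover.
have [c [d [cL dU dE ac db]]] := adjacent_switch cover aL bU ab.
have [_ _ /(_ v d) + _] := hM.
have v0 : 0 < v < r by rewrite ltn_ord vE.
have d0 : 0 < d < k by rewrite ltn_ord dE.
move: cL dU; rewrite !inE => /existsP[i /andP[vi Mic]] /existsP[i' /andP[iu Mid]].
move/(_ v0 d0); rewrite /cw_ok.
rewrite (only_zerosPn (i := i') (j := d)) //; last by rewrite inE /= vE ltnS iu /=.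
rewrite (only_zerosPn (i := u) (j := p)) //; last first.
  by rewrite inE /= vE eqxx dE ltnS (leq_trans pa).
rewrite (only_zerosPn (i := v) (j := q)) //; last first.
  by rewrite inE /= eqxx (leq_trans db).
by rewrite (only_zerosPn (i := i) (j := c)) // inE /= vi dE eqxx.
Qed.

Lemma card_extra_low_extra_le2 :
  #|[set j | (v, j) \in extra_ones M]| + #|[set j | (u, j) \in low_extra_ones M]|
    <= 2.
Proof.
have -> : [set j | (v, j) \in extra_ones M] = row_ones M v :&: ones_down_to M u.
  apply/setP => j; rewrite inE extra_onesE !inE; congr (_ && _).
  by apply: eq_existsb => i; rewrite vE ltnS.
have -> : [set j | (u, j) \in low_extra_ones M]
        = row_ones M u :&: ones_down_from M v.
  by apply/setP => j; rewrite !inE /=; congr (_ && _);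
     apply: eq_existsb => i; rewrite vE.
have [row1 _ _ _] := hM.
apply: card_switch_le2 no_switch_ccw no_switch_cw _ _ _ _.
- by apply/subsetP => j; rewrite !inE => Mj; apply/existsP; exists u; rewrite leqnn.
- by apply/subsetP => j; rewrite !inE => Mj; apply/existsP; exists v; rewrite leqnn.
- by have [j Mj] := row1 u; apply/set0Pn; exists j; rewrite inE.
- by have [j Mj] := row1 v; apply/set0Pn; exists j; rewrite inE.
Qed.

End ConsecutiveRows.

(** * Counting the extra 1s *)

Lemma card_rows r k (S : {set 'I_r * 'I_k}) :
  #|S| = \sum_(i < r) #|[set j | (i, j) \in S]|.
Proof.
rewrite -sum1_card.
rewrite (eq_bigr (fun i : 'I_r => \sum_(j | (i, j) \in S) 1)); last first.
  by move=> i _; rewrite -sum1_card; apply: eq_bigl => j; rewrite inE.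
by rewrite pair_big_dep; apply: eq_bigl => -[i j].
Qed.

(** Each column has a topmost 1, and at most one bottommost 1. Both sets of
    extra 1s come from the set of all 1s by removing one of these. *)
Lemma card_extra_le_low_extra r k (M : 'M[bool]_(r, k)) :
  (forall j, exists i, M i j) -> #|extra_ones M| <= #|low_extra_ones M|.
Proof.
move=> col1; pose ones := [set p : 'I_r * 'I_k | M p.1 p.2].
have sE : extra_ones M \subset ones by apply/subsetP => p; rewrite !inE => /andP[].
have sF : low_extra_ones M \subset ones
  by apply/subsetP => p; rewrite !inE => /andP[].
have top_ge : k <= #|ones :\: extra_ones M|.
  rewrite -{1}(card_ord k) -cardsT.
  have sub : [set: 'I_k] \subset [set p.2 | p in ones :\: extra_ones M].
    apply/subsetP => j _; have [i Mij] := col1 j.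
    case: (arg_minnP (P := fun i : 'I_r => M i j) (fun i : 'I_r => val i) Mij)
      => t Mtj tmin.
    apply/imsetP; exists (t, j) => //; rewrite inE extra_onesE inE /= Mtj andbT /=.
    by apply/existsP => -[i' /andP[lt /tmin]]; rewrite leqNgt lt.
  exact: leq_trans (subset_leq_card sub) (leq_imset_card _ _).
have bot_le : #|ones :\: low_extra_ones M| <= k.
  rewrite -[in leqRHS](card_ord k) -(card_in_imset (f := snd)); first exact: max_card.
  move=> [i j] [i' j']; rewrite !inE /= => /andP[n1 Mij] /andP[n2 Mij'] jj'.
  rewrite jj' in Mij n1 *.
  congr pair; apply/val_inj; case: (ltngtP i i') => // lt; last first.
    by case/negP: n2; rewrite Mij'; apply/existsP; exists i; rewrite lt.
  by case/negP: n1; rewrite Mij; apply/existsP; exists i'; rewrite lt.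
move: (leq_trans bot_le top_ge); rewrite !cardsDS //.
by rewrite leq_sub2lE // subset_leq_card.
Qed.

Theorem theorem6 (r k : nat) (r_ge1 : 1 <= r) (k_ge1 : 1 <= k)
    (M : 'M[bool]_(r, k)) (hM : Baxter_matrix M) :
  #|extra_ones M| < r.
Proof.
case: r r_ge1 M hM => // n _ M hM; rewrite ltnS.
have first_row : #|[set j | (ord0, j) \in extra_ones M]| = 0.
  apply/eqP; rewrite cards_eq0; apply/eqP/setP => j.
  rewrite inE extra_onesE in_set0; apply/negP => /andP[_ /existsP[i]].
  by rewrite ltn0.
have last_row : #|[set j | (ord_max, j) \in low_extra_ones M]| = 0.
  apply/eqP; rewrite cards_eq0; apply/eqP/setP => j.
  rewrite !inE; apply/negP => /andP[_ /existsP[i]] /=.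
  by rewrite ltnNge -ltnS ltn_ord.
have [_ col1 _ _] := hM.
suff le : #|extra_ones M| + #|low_extra_ones M| <= n.*2.
  rewrite -leq_double -addnn; apply: leq_trans le.
  by rewrite leq_add2l card_extra_le_low_extra.
rewrite !card_rows big_ord_recl first_row add0n big_ord_recr /= last_row addn0.
rewrite -big_split /= -muln2 -[in leqRHS](card_ord n) -sum_nat_const.
by apply: leq_sum => i _; apply: card_extra_low_extra_le2.
Qed.
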